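(* Let $d\geq1$, let $c_1,\dots,c_d\in\mathbb{C}$ with $c_d\neq0$, and let the complex sequence $\{a_k\}_{k=0}^\infty$ satisfy the linear recurrence relation with constant coefficients $$a_k=\sum_{j=1}^{d}c_ja_{k-j},\qquad k=d,d+1,\dots.$$ Let $\sigma_1,\dots,\sigma_d$ be its characteristic roots, i.e. the roots (with multiplicity) of $\sigma^d-\sum_{j=1}^dc_j\sigma^{d-j}=0$, and put $R=\min_{i=1,\dots,d}|\sigma_i^{-1}|$. Then for each $k\geq d$ $$|a_k|R^k\leq Q(k,d)\max_{i=0,\dots,d-1}|a_i|R^i,\qquad\text{where } Q(k,d)=\left[2e\left(\frac kd+1\right)\right]^d .$$
   Context: Here $e$ is the base of the natural logarithm. *)

(* Defs.v *)
From HB Require Import structures.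
From mathcomp Require Import all_boot all_order all_algebra.
From mathcomp Require Import complex.
From mathcomp Require Import reals sequences exp.

Set Implicit Arguments.
Unset Strict Implicit.
Unset Printing Implicit Defensive.

Import Order.TTheory GRing.Theory Num.Theory.
Local Open Scope ring_scope.

(* The modulus with values in R; the generic norm `|z| is R[i]-valued. *)
Notation cmod := ComplexField.Normc.normc.

(* Only the values c 1, ..., c d are used. *)
Definition charpoly (R : realType) (d : nat) (c : nat -> R[i]) : {poly R[i]} :=
  'X^d - \sum_(1 <= j < d.+1) c j *: 'X^(d - j).

(* Minimum and maximum of the nonempty family F 0, ..., F (d - 1); starting
   the iteration at F 0 does not change the value. *)
Definition min_fam (R : realType) (d : nat) (hd : (0 < d)%N) (F : 'I_d -> R)
    : R :=
  \big[Num.min/F (Ordinal hd)]_(i < d) F i.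

Definition max_fam (R : realType) (d : nat) (hd : (0 < d)%N) (F : 'I_d -> R)
    : R :=
  \big[Num.max/F (Ordinal hd)]_(i < d) F i.

Definition Qbound (R : realType) (k d : nat) : R :=
  (2 * expR 1 * (k%:R / d%:R + 1)) ^+ d.

(* Main.v *)
Require Import Defs.
From mathcomp Require Import all_boot all_order all_algebra.
From mathcomp Require Import complex.
From mathcomp Require Import reals sequences exp.
From mathcomp Require Import lra.
Import Order.TTheory GRing.Theory Num.Theory.
Local Open Scope ring_scope.

(** In terms of the generating function [A(X) = \sum_k a_k X^k], the recurrence
    says that [y := A * \prod_i (1 - sigma_i X)] is a polynomial of degree less
    than [d].  Multiplication by [1 - z X] is the operator [subshift z] on
    sequences, so [y] is obtained from [a] by applying [subshift] once for each
    characteristic root.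

    Measure sequences by the weighted moduli [|x_k| rho^k].  Since
    [|sigma_i| rho <= 1], one [subshift] at most doubles a bound on the first
    [d] weighted moduli ([subshifts_bound]), hence [|y_k| rho^k <= K] for
    [k < d], where [K = 2^d M] and [M] is the maximum over the initial values.
    As [y_k = 0] for [k >= d] ([subshiftsE]), the bound [K] holds for all [k].
    Conversely, inverting one [subshift] costs at most one partial summation;
    the [d]-fold partial sums of the constant sequence [K] are [K * C(k + d, d)]
    ([subshifts_inv_bound]).  It remains to use [d^d / d! <= e^d], which gives
    [C(k + d, d) <= (k + d)^d / d! <= (e (k + d) / d)^d] ([bin_le_expR]). *)

(** The coefficients of the product of [1 - z X] and [\sum_k x_k X^k]. *)
Definition subshift {A : nzRingType} (z : A) (x : nat -> A) (k : nat) : A :=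
  if k is k'.+1 then x k'.+1 - z * x k' else x 0%N.

Definition subshifts {A : nzRingType} (s : seq A) (x : nat -> A) : nat -> A :=
  foldr subshift x s.

(** From index [size s] on no value [x_k] with [k < 0] is involved, so that the
    composite operator acts as the polynomial with root list [s] evaluated at
    the forward shift. *)
Lemma subshiftsE (A : comNzRingType) (s : seq A) (x : nat -> A) (m : nat) :
  subshifts s x (m + size s) =
  \sum_(i < (size s).+1) (\prod_(z <- s) ('X - z%:P))`_i * x (m + i)%N.
Proof.
elim: s m => [|z s IHs] m /=.
  by rewrite addn0 big_ord_recl big_ord0 big_nil coef1 mul1r !addr0 addn0.
set P := \prod_(w <- s) ('X - w%:P).
have Pn1 : P`_(size s).+1 = 0 by rewrite nth_default // size_prod_XsubC.
rewrite big_cons -/P addnS /= -addSn !IHs.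
under [RHS]eq_bigr => i _ do rewrite mulrBl coefB coefXM coefCM mulrBl -mulrA.
rewrite sumrB; congr (_ - _).
  rewrite [RHS]big_ord_recl /= mul0r add0r.
  by apply: eq_bigr => i _; rewrite /bump /= addnS.
by rewrite [RHS]big_ord_recr /= -/P Pn1 mul0r mulr0 addr0 mulr_sumr.
Qed.

Section WeightedBounds.
Context {R : rcfType} {rho : R} (rho_ge0 : 0 <= rho).

Lemma cmod_ge0 (z : R[i]) : 0 <= cmod z.
Proof. by case: z => a b; exact: sqrtr_ge0. Qed.

(** This is where the size of the roots enters: on the generating function,
    multiplication by [z X] does not increase the weighted moduli. *)
Lemma cmod_shift_le (z u : R[i]) (k : nat) : cmod z * rho <= 1 ->
  cmod (z * u) * rho ^+ k.+1 <= cmod u * rho ^+ k.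
Proof.
move=> hz; rewrite Normc.normcM exprS mulrACA ler_piMl //.
by rewrite mulr_ge0 ?cmod_ge0 ?exprn_ge0.
Qed.

Lemma cmodD_weight_le (u v : R[i]) (k : nat) :
  cmod (u + v) * rho ^+ k <= cmod u * rho ^+ k + cmod v * rho ^+ k.
Proof. by rewrite -mulrDl ler_wpM2r ?exprn_ge0 ?le_normcD. Qed.

Lemma cmodB_weight_le (u v : R[i]) (k : nat) :
  cmod (u - v) * rho ^+ k <= cmod u * rho ^+ k + cmod v * rho ^+ k.
Proof. by rewrite -[cmod v]normcN cmodD_weight_le. Qed.

(** Each factor at most doubles the bound, and on a prefix of the sequence
    only the bound on the same prefix is needed. *)
Lemma subshifts_bound (s : seq R[i]) (x : nat -> R[i]) (N : nat) (M : R) :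
  all (fun z => cmod z * rho <= 1) s ->
  (forall k, (k < N)%N -> cmod (x k) * rho ^+ k <= M) ->
  forall k, (k < N)%N ->
    cmod (subshifts s x k) * rho ^+ k <= 2 ^+ size s * M.
Proof.
move=> hs hx; elim: s hs => [_|z s IHs /= /andP[hz /IHs{}IHs]] k hk.
  by rewrite mul1r hx.
have dbl : 2 ^+ (size s).+1 * M = 2 ^+ size s * M + 2 ^+ size s * M.
  by rewrite exprS -mulrA mulrDl !mul1r.
rewrite dbl; case: k hk => [|k] hk /=.
  have := IHs _ hk; have : 0 <= cmod (subshifts s x 0%N) * rho ^+ 0.
    by rewrite mulr_ge0 ?cmod_ge0 ?exprn_ge0.
  rewrite /subshifts; lra.
apply: le_trans (cmodB_weight_le _ _ _) _; apply: lerD; first exact: IHs.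
by apply: le_trans (cmod_shift_le _ _ _ hz) _; apply: IHs; apply: ltnW.
Qed.

(** Since [x_k = (subshift z x)_k + z x_(k-1)], a bound [K * C(k + n, n)] on
    [subshift z x] sums to a bound on [x] by Pascal's rule. *)
Lemma subshift_inv_bound (z : R[i]) (x : nat -> R[i]) (K : R) (n : nat) :
  cmod z * rho <= 1 ->
  (forall k, cmod (subshift z x k) * rho ^+ k <= K * 'C(k + n, n)%:R) ->
  forall k, cmod (x k) * rho ^+ k <= K * 'C(k + n.+1, n.+1)%:R.
Proof.
move=> hz hx; elim=> [|k IHk]; first by have := hx 0%N; rewrite !add0n !binn.
rewrite -[x k.+1](subrK (z * x k)) addSn binS natrD mulrDr addrC.
apply: le_trans (cmodD_weight_le _ _ _) _; rewrite addrC [leRHS]addrC.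
apply: lerD; first by have := hx k.+1; rewrite addSnnS.
exact: le_trans (cmod_shift_le _ _ _ hz) IHk.
Qed.

Lemma subshifts_inv_bound (s : seq R[i]) (x : nat -> R[i]) (K : R) :
  all (fun z => cmod z * rho <= 1) s ->
  (forall k, cmod (subshifts s x k) * rho ^+ k <= K) ->
  forall k, cmod (x k) * rho ^+ k <= K * 'C(k + size s, size s)%:R.
Proof.
move=> hs hx.
suff aux n : all (fun z => cmod z * rho <= 1) s ->
    (forall k, cmod (subshifts s x k) * rho ^+ k <= K * 'C(k + n, n)%:R) ->
    forall k, cmod (x k) * rho ^+ k <=
      K * 'C(k + (n + size s), n + size s)%:R.
  by apply: (aux 0%N hs) => k; rewrite bin0 mulr1.
elim: s n {hs hx} => [|z s IHs] n /=; first by move=> _ hx k; rewrite addn0.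
move=> /andP[hz hs] /(subshift_inv_bound _ _ _ _ hz) hx k.
by rewrite addnS -addSn; apply: IHs.
Qed.

End WeightedBounds.

(** From [C(k + d, d) <= (k + d)^d / d!] and [d^d / d! <= e^d]. *)
Lemma bin_le_expR (R : realType) (k d : nat) : (0 < d)%N ->
  'C(k + d, d)%:R <= (expR 1 * (k%:R / d%:R + 1)) ^+ d :> R.
Proof.
move=> hd; have d0 : d%:R != 0 :> R by rewrite pnatr_eq0 -lt0n.
have f0 : 0 < d`!%:R :> R by rewrite ltr0n fact_gt0.
have dexp : d%:R ^+ d / d`!%:R <= expR 1 ^+ d :> R.
  (* A single term of the exponential series at [d] is below its sum. *)
  rewrite -expRM_natr mul1r; case: d hd {d0 f0} => // d _.
  by have := @expR_ge1Dxn R d.+1%:R d (ler0n _ _); lra.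
have -> : k%:R / d%:R + 1 = (k + d)%:R / d%:R :> R.
  by rewrite natrD mulrDl divff.
have ffact_le : ((k + d) ^_ d <= (k + d) ^ d)%N.
  have -> : ((k + d) ^ d = \prod_(i < d) (k + d))%N.
    by rewrite prod_nat_const card_ord.
  by rewrite ffact_prod; apply: leq_prod => i _; apply: leq_subr.
rewrite -(ler_pM2r f0) -natrM bin_ffact exprMn expr_div_n.
apply: le_trans (_ : (k + d)%:R ^+ d <= _); first by rewrite -natrX ler_nat.
set N := (k + d)%:R ^+ d.
have N_ge0 : 0 <= N / d%:R ^+ d by rewrite divr_ge0 // exprn_ge0.
rewrite -[leLHS](_ : d%:R ^+ d / d`!%:R * (N / d%:R ^+ d) * d`!%:R = N).
  by rewrite ler_pM2r // ler_wpM2r.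
by rewrite mulrAC divfK ?gt_eqF // mulrC divfK ?expf_neq0.
Qed.

(** The recurrence at index [m + d] says that the characteristic polynomial,
    evaluated at the forward shift, kills [a] at [m]; in this form
    [subshiftsE] applies to it. *)
Lemma charpoly_recurrence (R : realType) (d : nat) (c a : nat -> R[i]) (m : nat) :
  a (m + d)%N = \sum_(1 <= j < d.+1) c j * a (m + d - j)%N ->
  \sum_(i < d.+1) (charpoly d c)`_i * a (m + i)%N = 0.
Proof.
move=> ham; rewrite /charpoly.
under eq_bigr => i _ do rewrite coefB coefXn coef_sum mulrBl mulr_suml.
rewrite sumrB exchange_big /= big_ord_recr /= eqxx mul1r.
rewrite big1 ?add0r => [|i _]; last by rewrite (ltn_eqF (ltn_ord i)) mul0r.
rewrite ham; apply/eqP; rewrite subr_eq0; apply/eqP.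
apply: eq_big_nat => j /andP[_ hj].
(* The monomial [c_j X^(d-j)] only meets the term [i = d - j]. *)
rewrite (bigD1 (inord (d - j))) //= big1 ?addr0 => [|i].
  rewrite inordK ?ltnS ?leq_subr // coefZ coefXn eqxx mulr1.
  by rewrite addnBA.
rewrite -val_eqE /= inordK ?ltnS ?leq_subr // => hi.
by rewrite coefZ coefXn (negbTE hi) mulr0 mul0r.
Qed.

Theorem theorem3p1 (R : realType) (d : nat) (hd : (0 < d)%N)
    (c : nat -> R[i]) (hcd : c d != 0)
    (a : nat -> R[i])
    (ha : forall k : nat, (d <= k)%N ->
      a k = \sum_(1 <= j < d.+1) c j * a (k - j)%N)
    (sigma : 'I_d -> R[i])
    (hsigma : charpoly d c = \prod_(i < d) ('X - (sigma i)%:P))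
    (rho : R) (hrho : rho = min_fam hd (fun i => cmod (sigma i)^-1))
    (k : nat) (hk : (d <= k)%N) :
  cmod (a k) * rho ^+ k
    <= Qbound R k d * max_fam hd (fun i => cmod (a i) * rho ^+ i).
Proof.
have rho_ge0 : 0 <= rho.
  by rewrite hrho; apply/bigmin_geP; split=> [|i _]; exact: cmod_ge0.
set M := max_fam _ _.
have initM i : (i < d)%N -> cmod (a i) * rho ^+ i <= M.
  by move=> hi; apply: (le_bigmax _ (fun i : 'I_d => _) (Ordinal hi)).
have M_ge0 : 0 <= M.
  by apply: le_trans (initM _ hd); rewrite mulr_ge0 ?cmod_ge0 ?exprn_ge0.
pose s := [seq sigma i | i <- enum 'I_d].
have size_s : size s = d by rewrite size_map size_enum_ord.
have s_le1 : all (fun z => cmod z * rho <= 1) s.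
  apply/allP => _ /mapP[i _ ->].
  have : rho <= (cmod (sigma i))^-1.
    by rewrite -Normc.normcV hrho; apply: bigmin_le.
  have := cmod_ge0 (sigma i); rewrite le_eqVlt => /predU1P[<- _|s_gt0].
    by rewrite mul0r ler01.
  by move=> hle; rewrite -(divff (lt0r_neq0 s_gt0)) ler_pM2l.
have bound_y i : cmod (subshifts s a i) * rho ^+ i <= 2 ^+ d * M.
  have [hi|hi] := ltnP i d.
    by rewrite -size_s; apply: subshifts_bound hi.
  have -> : subshifts s a i = 0.
    rewrite -(subnK hi) -{2}size_s subshiftsE size_s big_map big_enum -hsigma.
    by apply: charpoly_recurrence; apply: ha; rewrite leq_addl.
  by rewrite Normc.normc0 mul0r mulr_ge0 ?exprn_ge0.
have := subshifts_inv_bound rho_ge0 _ _ _ s_le1 bound_y k; rewrite size_s.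
move=> /le_trans; apply.
rewrite [leLHS]mulrAC /Qbound -[2 * _ * _]mulrA exprMn.
apply: ler_wpM2r => //.
by rewrite ler_wpM2l ?exprn_ge0 // bin_le_expR.
Qed.
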